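(* Let $\alpha,a\in\mathbb{R}$. For every integer $\nu\ge 1$ and all $x\in\mathbb{R}$, $$Q^{(\alpha,-a)}_{\nu+1}(x)=[\alpha-2x(a+\nu+1)]\,Q^{(\alpha,-a)}_{\nu}(x)-\nu\,\sigma(x)(2a+\nu+1)\,Q^{(\alpha,-a)}_{\nu-1}(x),$$ and for $\nu=0$ the same relation holds with the last term read as $0$.
   Context: Throughout $x$ is a real variable, $\alpha,a$ are real parameters, $\sigma(x)=1+x^2$, and $\cot^{-1}:\mathbb{R}\to(0,\pi)$ is the smooth branch, so that $\frac{d}{dx}\cot^{-1}x=-1/\sigma(x)$. For integers $l\ge 0$ put $w_l(x)=\sigma(x)^{-(l+a+1)}e^{-\alpha\cot^{-1}x}=\sigma(x)^{-l}w_0(x)$. Define $P_l^{(a,\alpha)}(x)=\frac{1}{w_l(x)}\frac{d^l}{dx^l}[w_l(x)\sigma(x)^l]=\frac{\sigma(x)^l}{w_0(x)}\frac{d^l w_0(x)}{dx^l}$. The complementary (Romanovski) polynomials $Q_\nu^{(\alpha,-a)}$, with $Q_0^{(\alpha,-a)}\equiv 1$, are defined by the Rodrigues representation $P_l^{(a,\alpha)}(x)=\frac{1}{w_l(x)}\frac{d^{l-\nu}}{dx^{l-\nu}}[\sigma(x)^{l-\nu}w_l(x)Q_\nu^{(\alpha,-a)}(x)]$ for all integers $0\le\nu\le l$ (the case $l=\nu$ reads $Q_\nu^{(\alpha,-a)}=P_\nu^{(a,\alpha)}$). The second upper index is minus the parameter $a$ of the weight. *)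

(* Defs.v *)
From Stdlib Require Import Reals Lra Lia.
From Coquelicot Require Import Coquelicot.
Open Scope R_scope.

Definition rsigma (x : R) : R := 1 + x ^ 2.

(** Smooth branch of the inverse cotangent, with values in (0, PI); see
    [acot_bound], [cot_acot] and [is_derive_acot]. *)
Definition acot (x : R) : R := PI / 2 - atan x.

Definition w (a alpha : R) (l : nat) (x : R) : R :=
  Rpower (rsigma x) (- (INR l + a + 1)) * exp (- alpha * acot x).

(** P_l^(a, alpha) *)
Definition romanovski (a alpha : R) (l : nat) (x : R) : R :=
  1 / w a alpha l x
  * Derive_n (fun y => w a alpha l y * rsigma y ^ l) l x.

(** [Q nu] stands for Q_nu^(alpha, -a): the parameter [a] here is the one of
    the weight.  The instance [l = nu] determines [Q nu], so the predicate has
    at most one solution; [romanovski_complementary] shows that there is one.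
    In particular all the functions differentiated below are smooth, and the
    total operator [Derive_n] denotes a genuine iterated derivative. *)
Definition complementary_romanovski (alpha a : R) (Q : nat -> R -> R) : Prop :=
  (forall x, Q 0%nat x = 1) /\
  (forall (l nu : nat) (x : R), (nu <= l)%nat ->
     romanovski a alpha l x =
     1 / w a alpha l x
     * Derive_n (fun y => rsigma y ^ (l - nu) * w a alpha l y * Q nu y)
         (l - nu) x).

Lemma rsigma_gt0 x : 0 < rsigma x.
Proof. unfold rsigma; nra. Qed.

Lemma acot_bound x : 0 < acot x < PI.
Proof. unfold acot; generalize (atan_bound x); lra. Qed.

Lemma cot_acot x : cos (acot x) / sin (acot x) = x.
Proof.
  unfold acot; rewrite cos_shift, sin_shift.
  exact (tan_atan x).
Qed.

Lemma is_derive_acot x : is_derive acot x (- 1 / rsigma x).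
Proof.
  generalize (rsigma_gt0 x); intros Hs.
  replace (- 1 / rsigma x) with (0 - / (1 + x ^ 2)) by (unfold rsigma in *; field; lra).
  apply (is_derive_minus (fun _ => PI / 2) atan).
  - apply (is_derive_const (K := R_AbsRing) (V := R_NormedModule)).
  - apply is_derive_Reals.
    apply derivable_pt_lim_atan.
Qed.

Lemma w_gt0 a alpha l x : 0 < w a alpha l x.
Proof. apply Rmult_lt_0_compat; apply exp_pos. Qed.

Lemma w_rsigma a alpha l x : w a alpha l x * rsigma x ^ l = w a alpha 0 x.
Proof.
  unfold w; rewrite <- (Rpower_pow l _ (rsigma_gt0 x)).
  rewrite Rmult_assoc, (Rmult_comm (exp _)), <- Rmult_assoc, <- Rpower_plus.
  f_equal; f_equal; simpl INR; ring.
Qed.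

Lemma romanovskiE a alpha l x :
  romanovski a alpha l x = rsigma x ^ l / w a alpha 0 x * Derive_n (w a alpha 0) l x.
Proof.
  unfold romanovski; rewrite (Derive_n_ext _ _ l x (w_rsigma a alpha l)).
  rewrite <- (w_rsigma a alpha l x).
  generalize (w_gt0 a alpha l x) (pow_lt _ l (rsigma_gt0 x)); intros.
  field; lra.
Qed.

Lemma romanovski_complementary a alpha :
  complementary_romanovski alpha a (romanovski a alpha).
Proof.
  split.
  - intros x; rewrite romanovskiE; simpl.
    generalize (w_gt0 a alpha 0 x); intros; field; lra.
  - intros l nu x Hl.
    rewrite (Derive_n_ext _ (Derive_n (w a alpha 0) nu)).
    + rewrite Derive_n_comp.
      replace (l - nu + nu)%nat with l by lia.
      unfold romanovski.
      now rewrite (Derive_n_ext _ _ l x (w_rsigma a alpha l)).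
    + intros y; rewrite romanovskiE, <- (w_rsigma a alpha l y).
      replace (rsigma y ^ l) with (rsigma y ^ (l - nu) * rsigma y ^ nu)
        by (rewrite <- pow_add; f_equal; lia).
      generalize (w_gt0 a alpha l y) (pow_lt _ nu (rsigma_gt0 y))
        (pow_lt _ (l - nu) (rsigma_gt0 y)); intros.
      field; lra.
Qed.

(* Main.v *)
Require Import Defs.
From Stdlib Require Import Reals Arith Lra Lia.
From Coquelicot Require Import Coquelicot.
Open Scope R_scope.

(** Taking [l = nu] in the Rodrigues representation gives
    [Q nu = rsigma ^ nu / w_0 * w_0^(nu)], so the recurrence for [Q] is a
    relation between three consecutive derivatives of the weight [w_0].  That
    relation comes from the Pearson equation
    [rsigma * w_0' = (alpha - 2 * (a + 1) * x) * w_0] ([is_derive_w0]) by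
    differentiating it [n] times.  Since [rsigma] is quadratic and the other
    factor linear, Leibniz' rule stops after a few terms:
    [rsigma * w_0^(n+1) + 2 * n * x * w_0^(n) + n * (n - 1) * w_0^(n-1)
     = (alpha - 2 * (a + 1) * x) * w_0^(n) - 2 * (a + 1) * n * w_0^(n-1)].
    Collecting terms, with [2 * (a + 1) + n - 1 = 2 * a + n + 1], and multiplying
    by [rsigma ^ n / w_0] gives the theorem. *)

(** The operator [Derive_n] is total, so differentiability of each derivative
    has to be established as well.  Dividing by [rsigma] makes the formula do
    both jobs: it expresses the [n+1]-st derivative through earlier ones, and so
    shows that it is differentiable in turn.  The index [n - 1] is truncated
    at [n = 0], where the factor [INR n] kills that term. *)
Lemma is_derive_Derive_n_Pearson (alpha a : R) (f : R -> R)
  (Hf : forall x, is_derive f x ((alpha - 2 * (a + 1) * x) * f x / rsigma x))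
  (n : nat) (x : R) :
  is_derive (Derive_n f n) x
    (((alpha - 2 * (a + 1 + INR n) * x) * Derive_n f n x
      - INR n * (2 * a + INR n + 1) * Derive_n f (n - 1) x) / rsigma x).
Proof.
  revert x; induction n as [n IH] using lt_wf_ind; intros x.
  destruct n as [|n].
  - simpl; replace (_ / _) with ((alpha - 2 * (a + 1) * x) * f x / rsigma x)
      by (unfold Rdiv; ring).
    apply Hf.
  - assert (HD : forall k y, (k <= n)%nat ->
        is_derive (Derive_n f k) y (Derive_n f (S k) y)).
    { intros k y Hk; apply Derive_correct; eexists; apply IH; lia. }
    assert (HS : forall y, Derive_n f (S n) y =
        ((alpha - 2 * (a + 1 + INR n) * y) * Derive_n f n y
         - INR n * (2 * a + INR n + 1) * Derive_n f (n - 1) y) / rsigma y).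
    { intros y; apply is_derive_unique, IH; lia. }
    replace (S n - 1)%nat with n by lia.
    assert (Hpred : INR n * Derive_n f (S (n - 1)) x = INR n * Derive_n f n x).
    { destruct n as [|n]; [simpl; ring|].
      now replace (S (S n - 1)) with (S n) by lia. }
    generalize (rsigma_gt0 x); intros Hs.
    (* The quotient rule applied to [HS], with derivatives as opaque values. *)
    eapply is_derive_ext; [intros y; symmetry; apply HS|].
    generalize (HD n x (le_n n)) (HD (n - 1)%nat x ltac:(lia)) (HS x) Hpred.
    generalize (Derive_n f (S (n - 1)) x) (Derive_n f (S n) x).
    generalize (Derive_n f n) (Derive_n f (n - 1)).
    intros g h hd gd Hg Hh Hgd Hhd.
    unfold rsigma in *.
    auto_derive.
    + repeat split; try (eexists; eassumption); lra.
    + replace (Derive (fun y => g y) x) with gd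
        by (symmetry; now apply is_derive_unique).
      replace (Derive (fun y => h y) x) with hd
        by (symmetry; now apply is_derive_unique).
      replace (INR n * (2 * a + INR n + 1) * (1 * hd))
        with ((2 * a + INR n + 1) * (INR n * g x)) by (rewrite <- Hhd; ring).
      (* The numerator, which the quotient rule leaves undifferentiated in one
         term, is again [rsigma] times the derivative of [g]. *)
      replace ((alpha + - (2 * (a + 1 + INR n) * x)) * g x
               + - (INR n * (2 * a + INR n + 1) * h x))
        with (gd * (1 + x ^ 2)) by (rewrite Hgd; field; lra).
      rewrite S_INR; field; lra.
Qed.

(** Pearson's equation for the weight; the [alpha] comes from
    [acot' = - 1 / rsigma]. *)
Lemma is_derive_w0 (a alpha x : R) :
  is_derive (w a alpha 0) x
    ((alpha - 2 * (a + 1) * x) * w a alpha 0 x / rsigma x).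
Proof.
  generalize (rsigma_gt0 x) (is_derive_acot x); intros Hs Hacot.
  unfold w, Rpower.
  auto_derive.
  - repeat split; try (eexists; eassumption).
    + unfold rsigma; auto_derive; trivial.
    + exact Hs.
  - replace (Derive (fun y => acot y) x) with (- 1 / rsigma x)
      by (symmetry; now apply is_derive_unique).
    replace (Derive (fun y => rsigma y) x) with (2 * x)
      by (symmetry; apply is_derive_unique; unfold rsigma; auto_derive;
          [trivial | ring]).
    simpl INR; field; lra.
Qed.

(** The case [l = nu] of the Rodrigues representation involves no derivative of
    [Q nu], so it can be solved for [Q nu]. *)
Lemma complementary_romanovski_unique (alpha a : R) (Q : nat -> R -> R) :
  complementary_romanovski alpha a Q ->
  forall nu x, Q nu x = romanovski a alpha nu x.
Proof.
  intros [_ HQ] nu x.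
  rewrite (HQ nu nu x (le_n nu)), Nat.sub_diag; simpl.
  generalize (w_gt0 a alpha nu x); intros; field; lra.
Qed.

Lemma romanovski_recurrence (alpha a : R) (n : nat) (x : R) :
  romanovski a alpha (n + 1) x =
    (alpha - 2 * x * (a + INR n + 1)) * romanovski a alpha n x
    - INR n * rsigma x * (2 * a + INR n + 1) * romanovski a alpha (n - 1) x.
Proof.
  rewrite !romanovskiE, Nat.add_1_r.
  change (Derive_n (w a alpha 0) (S n) x)
    with (Derive (Derive_n (w a alpha 0) n) x).
  rewrite (is_derive_unique _ _ _
    (is_derive_Derive_n_Pearson alpha a _ (is_derive_w0 a alpha) n x)).
  generalize (w_gt0 a alpha 0 x) (rsigma_gt0 x); intros.
  (* The truncated index [n - 1] matches the power of [rsigma] only for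
     [n > 0]; for [n = 0] its coefficient vanishes. *)
  destruct n as [|n].
  - simpl; field; lra.
  - replace (S n - 1)%nat with n by lia.
    simpl pow; field; lra.
Qed.

Theorem theorem1p8 (alpha a : R) (Q : nat -> R -> R)
  (HQ : complementary_romanovski alpha a Q) :
  (forall (nu : nat) (x : R), (1 <= nu)%nat ->
     Q (nu + 1)%nat x =
       (alpha - 2 * x * (a + INR nu + 1)) * Q nu x
       - INR nu * rsigma x * (2 * a + INR nu + 1) * Q (nu - 1)%nat x) /\
  (forall x : R,
     Q 1%nat x = (alpha - 2 * x * (a + INR 0 + 1)) * Q 0%nat x - 0).
Proof.
  split.
  - intros nu x _.
    rewrite !(complementary_romanovski_unique _ _ _ HQ).
    apply romanovski_recurrence.
  - intros x.
    rewrite !(complementary_romanovski_unique _ _ _ HQ).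
    rewrite (romanovski_recurrence alpha a 0 x : romanovski a alpha 1 x = _).
    simpl INR; ring.
Qed.
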